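(* For every priority channel system $S$, the structure $(\mathrm{Conf}_S,\to_{\#},\leq_{\#})$ is a well-structured transition system with stuttering compatibility; that is, $(\mathrm{Conf}_S,\leq_{\#})$ is a well-quasi-order, and whenever $C\to_{\#}D$ and $C\leq_{\#}C'$ there is a configuration $D'$ with $C'\to_{\#}^{+}D'$ and $D\leq_{\#}D'$.
   Context: For $d\in\mathbb{N}$ let $\Sigma_d=\{0,1,\ldots,d\}$. A level-$d$ priority channel system ($d$-PCS) is a tuple $S=(\Sigma_d,\mathrm{Ch},Q,\Delta)$ where $\mathrm{Ch}=\{c_1,\ldots,c_m\}$ is a finite set of channels, $Q$ is a finite set of control states, and $\Delta\subseteq Q\times \mathrm{Ch}\times\{!,?\}\times\Sigma_d\times Q$ is a set of rules, written $(q,c_i!a,q')$ (write) or $(q,c_i?a,q')$ (read). A priority channel system (PCS) is a $d$-PCS for some $d$. Configurations: $\mathrm{Conf}_S=Q\times(\Sigma_d^* )^m$. Reliable steps: a rule $(q,c_i?a,q')$ gives $(q,x_1,\ldots,x_m)\to(q',y_1,\ldots,y_m)$ if $x_i=a\,y_i$ and $x_j=y_j$ for $j\neq i$; a rule $(q,c_i!a,q')$ gives such a step if $y_i=x_i\,a$ and $x_j=y_j$ for $j\ne i$. Superseding on words: $x\to_{\#}y$ iff $x=a_1\cdots a_\ell$ and, for some $1\le k<\ell$, $a_k\le a_{k+1}$ and $y=a_1\cdots a_{k-1}a_{k+1}\cdots a_\ell$. The step relation $\to_{\#}$ on $\mathrm{Conf}_S$ consists of all reliable steps together with all internal superseding steps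 $(q,x_1,\ldots,x_m)\to_{\#}(q,y_1,\ldots,y_m)$ where $x_i\to_{\#}y_i$ for one index $i$ and $x_j=y_j$ for $j\neq i$. For configurations, $C\leq_{\#}D$ iff $C$ can be obtained from $D$ by a (possibly empty) sequence of internal superseding steps, i.e. $C=(p,y_1,\ldots,y_m)$, $D=(p,x_1,\ldots,x_m)$ and $x_i\to_{\#}^*y_i$ for all $i$. A quasi-order $(A,\leq_A)$ is a well-quasi-order if every infinite sequence $x_0,x_1,\ldots$ over $A$ has indices $i<j$ with $x_i\leq_A x_j$. *)

(* Defs.v *)
From HB Require Import structures.
From mathcomp Require Import all_boot.
From Stdlib Require Import Relation_Operators.

Set Implicit Arguments.
Unset Strict Implicit.
Unset Printing Implicit Defensive.

Section WSTS.
Context {A : Type}.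
Implicit Types (step le : A -> A -> Prop).

Definition quasi_order le : Prop :=
  (forall x, le x x) /\ (forall x y z, le x y -> le y z -> le x z).

Definition well_quasi_order le : Prop :=
  quasi_order le /\
  forall x : nat -> A, exists i j : nat, i < j /\ le (x i) (x j).

Definition stuttering_compatible step le : Prop :=
  forall C D C' : A, step C D -> le C C' ->
    exists D' : A, clos_trans A step C' D' /\ le D D'.

Definition stuttering_wsts step le : Prop :=
  well_quasi_order le /\ stuttering_compatible step le.

End WSTS.

Inductive op := Write | Read.

Definition bool_of_op (o : op) : bool := if o is Write then true else false.
Definition op_of_bool (b : bool) : op := if b then Write else Read.
Lemma bool_of_opK : cancel bool_of_op op_of_bool. Proof. by case. Qed.
HB.instance Definition _ := Finite.copy op (can_type bool_of_opK).

Definition letter (d : nat) := 'I_d.+1.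

Definition word (d : nat) := seq (letter d).

Record pcs (d : nat) := PCS {
  chan : finType;
  state : finType;
  rules : {set state * chan * op * letter d * state}
}.

(* Channel contents are read at the head of the word and written at its end. *)
Definition conf (d : nat) (S : pcs d) : Type :=
  (state S * {ffun chan S -> word d})%type.

Section Steps.
Context {d : nat}.

Inductive supersede : word d -> word d -> Prop :=
| Supersede (u v : word d) (a b : letter d) :
    a <= b -> supersede (u ++ a :: b :: v) (u ++ b :: v).

Context (S : pcs d).
Implicit Types (q : state S) (c : chan S) (x y : {ffun chan S -> word d}).

Inductive reliable_step : conf S -> conf S -> Prop :=
| ReadStep q c (a : letter d) q' x y :
    (q, c, Read, a, q') \in rules S ->
    x c = a :: y c -> (forall c', c' != c -> x c' = y c') ->
    reliable_step (q, x) (q', y)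
| WriteStep q c (a : letter d) q' x y :
    (q, c, Write, a, q') \in rules S ->
    y c = rcons (x c) a -> (forall c', c' != c -> x c' = y c') ->
    reliable_step (q, x) (q', y).

Inductive internal_step : conf S -> conf S -> Prop :=
| InternalStep q c x y :
    supersede (x c) (y c) -> (forall c', c' != c -> x c' = y c') ->
    internal_step (q, x) (q, y).

Definition pcs_step (C D : conf S) : Prop :=
  reliable_step C D \/ internal_step C D.

(* The smaller configuration is the target of the superseding steps. *)
Definition pcs_le (C D : conf S) : Prop :=
  clos_refl_trans (conf S) internal_step D C.

End Steps.

(* Main.v *)
Require Import Defs.
From mathcomp Require Import all_boot.
From Stdlib Require Import Relation_Operators Operators_Properties.
From Stdlib Require Import Classical ClassicalEpsilon.

Set Implicit Arguments.
Unset Strict Implicit.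
Unset Printing Implicit Defensive.

(** Stuttering compatibility is immediate: if C <= C' then C' supersedes down to
    C, so every step out of C can be simulated by C' with the same target.

    The words with letters at most k are well-quasi-ordered by induction on k.
    A word containing k reads u k v with u free of k, so it suffices to handle
    the words starting with k.  There Nash-Williams' minimal bad sequence
    argument applies: k u k v supersedes to its proper suffix k v, and
    superseding is a congruence for concatenation.  The leading k is essential,
    as u k v does not supersede to v in general. *)

(** * Well-quasi-orders on a predicate, and subsequences *)

Section WqoOn.
Context {A : Type}.
Implicit Types (le : A -> A -> Prop) (P : A -> Prop) (x w : nat -> A).

Definition good le x := exists i j, i < j /\ le (x i) (x j).

(** Relative to a predicate, so that the induction on the largest letter stays inside the single
    type [word d]. *)
Definition wqo_on P le := forall x, (forall n, P (x n)) -> good le x.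

Definition increasing (f : nat -> nat) := forall i j, i < j -> f i < f j.

Lemma increasing_comp f g : increasing f -> increasing g -> increasing (f \o g).
Proof. by move=> fP gP i j /gP /fP. Qed.

Lemma choice_fun (B : Type) (R : A -> B -> Prop) :
  (forall a, exists b, R a b) -> exists f, forall a, R a (f a).
Proof.
move=> H; exists (fun a => proj1_sig (constructive_indefinite_description _ (H a))).
by move=> a; case: constructive_indefinite_description.
Qed.

End WqoOn.

Lemma infinitely_often_subsequence (Q : nat -> Prop) :
  (forall n, exists m, n <= m /\ Q m) ->
  exists f, increasing f /\ forall n, Q (f n).
Proof.
move=> /choice_fun[next nextP].
pose f n := iter n (fun m => next m.+1) (next 0).
exists f; split.
  move=> i j; apply: (@homo_ltn _ f (fun a b => a < b)) => [y x z|n]; first exact: ltn_trans.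
  by case: (nextP (f n).+1).
by case=> [|n]; [case: (nextP 0) | case: (nextP (f n).+1)].
Qed.

(** * Chains and minimal bad sequences for a transitive relation *)

Section Transitive.
Context {A : Type} (le : A -> A -> Prop).
Hypothesis le_trans : forall x y z, le x y -> le y z -> le x z.

(** Infinitely many indices with nothing larger after them would form a bad subsequence; so beyond
    some [N] every entry has a later larger one, and iterating this choice yields the chain. *)
Lemma wqo_on_chain (P : A -> Prop) (x : nat -> A) :
  wqo_on P le -> (forall n, P (x n)) ->
  exists f, increasing f /\ forall i j, i < j -> le (x (f i)) (x (f j)).
Proof.
move=> wqoP Px.
have [N Nnext] : exists N, forall n, N <= n -> exists m, n < m /\ le (x n) (x m).
  apply: NNPP => Nno.
  have [|f [f_inc fT]] := @infinitely_often_subsequence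
    (fun n => ~ exists m, n < m /\ le (x n) (x m)).
    move=> n; apply: NNPP => nT; apply: Nno; exists n => m le_nm.
    by apply: NNPP => mT; apply: nT; exists m.
  have [i [j [lt_ij le_ij]]] := wqoP (x \o f) (fun n => Px (f n)).
  by apply: (fT i); exists (f j); split; first exact: f_inc.
have [n|next nextP] := @choice_fun nat nat
    (fun n m => N <= n -> n < m /\ le (x n) (x m)).
  have [/Nnext[m mP]|_] := leqP N n; last by exists 0.
  by exists m.
pose f n := iter n next N.
have fN n : N <= f n.
  by elim: n => // n IHn; have [/ltnW le_next _] := nextP _ IHn; exact: leq_trans le_next.
exists f; split.
  move=> i j; apply: (@homo_ltn _ f (fun a b => a < b)) => [y' x' z'|n]; first exact: ltn_trans.
  by case: (nextP _ (fN n)).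
move=> i j; apply: (@homo_ltn _ (x \o f) le) => [y' x' z'|n]; first exact: le_trans.
by case: (nextP _ (fN n)).
Qed.

(** Nash-Williams: [w] is built greedily, its entry [n] having least size among the bad sequences
    that share its first [n] entries. *)
Lemma minimal_bad_sequence (size : A -> nat) (P : A -> Prop) :
  ~ wqo_on P le ->
  exists w, (forall n, P (w n)) /\ ~ good le w /\
    forall f t, increasing f -> (forall n, P (t n)) ->
      (forall n, le (t n) (w (f n)) /\ size (t n) < size (w (f n))) -> good le t.
Proof.
move=> nwqo.
pose bad w := (forall n, P (w n)) /\ ~ good le w.
have [w0 bad0] : exists w, bad w.
  apply: NNPP => nbad; apply: nwqo => x Px; apply: NNPP => ngood.
  by apply: nbad; exists x.
pose agree n (v w : nat -> A) := forall i, i < n -> v i = w i.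
(* [step] keeps the first [n] entries of a bad [g] and minimises the next one; on a [g] that is not
   bad its value is arbitrary. *)
have [[n g]|step stepP] := @choice_fun (nat * (nat -> A)) (nat -> A)
  (fun ng g' => let: (n, g) := ng in bad g -> bad g' /\ agree n g' g /\
     forall h, bad h -> agree n h g -> size (g' n) <= size (h n)).
  have [bad_g|] := classic (bad g); last by exists g.
  have : exists h, bad h /\ agree n h g by exists g.
  suff: forall s h, size (h n) <= s -> bad h -> agree n h g ->
      exists g', bad g' /\ agree n g' g /\
        forall h', bad h' -> agree n h' g -> size (g' n) <= size (h' n).
    move=> H [h [bad_h agr_h]].
    by have [g' g'P] := H _ h (leqnn _) bad_h agr_h; exists g'.
  elim=> [|s IHs] h h_s bad_h agr_h.
    by exists h; split=> //; split=> // h' _ _; exact: leq_trans h_s _.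
  have [[h' [bad_h' [agr_h' lt_h']]]|min_h] := classic
      (exists h', bad h' /\ agree n h' g /\ size (h' n) < size (h n)).
    by apply: (IHs h') => //; rewrite -ltnS; exact: leq_trans lt_h' h_s.
  exists h; split=> //; split=> // h' bad_h' agr_h'; rewrite leqNgt.
  by apply/negP => lt_h'; apply: min_h; exists h'.
pose G := fix G n := if n is m.+1 then step (m, G m) else w0.
have badG n : bad (G n).
  by elim: n => // n IHn; case: (stepP (n, G n) IHn).
have GS n : agree n (G n.+1) (G n) by case: (stepP (n, G n) (badG n)) => _ [].
have Gagree i n : i < n -> G n i = G i.+1 i.
  elim: n => // n IHn; rewrite ltnS leq_eqVlt => /predU1P[-> //|lt_in].
  by rewrite (GS n) // IHn.
(* Diagonal: entry [n] is final from stage [n.+1] on. *)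
pose w n := G n.+1 n.
have Gmin n h : bad h -> agree n h w -> size (w n) <= size (h n).
  move=> bad_h agr_h; case: (stepP (n, G n) (badG n)) => _ [_ min_n].
  apply: (min_n h bad_h) => i lt_in.
  by rewrite agr_h // /w -(Gagree _ _ lt_in).
have Pw n : P (w n) by exact: (badG n.+1).1.
exists w; split=> //.
have w_bad : ~ good le w.
  case=> i [j [lt_ij le_ij]]; case: (badG j.+1) => _; apply; exists i, j; split=> //.
  by rewrite Gagree // ltnS ltnW.
split=> // f t f_inc Pt t_lt; apply: NNPP => t_bad.
(* Splicing a bad [t] onto the first [f 0] entries of [w] gives a bad sequence that is smaller at
   position [f 0], against [Gmin]. *)
pose h n := if n < f 0 then w n else t (n - f 0).
suff bad_h : bad h.
  have := Gmin (f 0) h bad_h; rewrite {2}/h ltnn subnn leqNgt (t_lt 0).2.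
  by move=> H; have: false by apply: H => i; rewrite /h => ->.
split=> [n|[i [j [lt_ij]]]].
  by rewrite /h; case: ifP.
rewrite /h; case: (ltnP i (f 0)) => [lt_i|le_i]; case: (ltnP j (f 0)) => [lt_j|le_j].
- by move=> le_ij; apply: w_bad; exists i, j.
(* A pair across the splice gives one inside [w], as [t k] lies below [w (f k)] and
   [i < f 0 <= f k]. *)
- move=> le_it; apply: w_bad; exists i, (f (j - f 0)); split.
    apply: leq_trans lt_i _; case: (j - f 0) => // k; exact/ltnW/f_inc.
  exact: le_trans le_it (t_lt _).1.
- by move: (leq_trans lt_j le_i); rewrite ltnNge (ltnW lt_ij).
- move=> le_tt; apply: t_bad; exists (i - f 0), (j - f 0); split=> //.
  by rewrite ltn_sub2r // (leq_ltn_trans le_i lt_ij).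
Qed.

End Transitive.

(** By the pigeonhole principle equality on a finite type is a well-quasi-order, and its chains are
    constant. *)
Lemma finite_constant_subsequence (T : finType) (x : nat -> T) :
  exists f, increasing f /\ exists a, forall n, x (f n) = a.
Proof.
have [||f [f_inc fE]] := @wqo_on_chain T eq (@eq_trans T) (fun=> True) x.
- move=> y _; apply: NNPP => ybad.
  suff /leq_card : injective (fun i : 'I_#|T|.+1 => y i) by rewrite card_ord ltnn.
  move=> i j eq_y; apply/val_inj; apply: NNPP => /eqP; rewrite neq_ltn.
  by case/orP=> lt_ij; apply: ybad; [exists i, j | exists j, i].
- by [].
by exists f; split=> //; exists (x (f 0)) => -[|n] //; rewrite (fE 0 n.+1).
Qed.

(** * Superseding on words *)

Section Words.
Context {d : nat}.
Implicit Types (u v x y : word d) (a k : letter d).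

Definition word_le x y := clos_refl_trans (word d) supersede y x.

Lemma word_le_trans x y z : word_le x y -> word_le y z -> word_le x z.
Proof. by move=> xy yz; exact: rt_trans yz xy. Qed.

Lemma supersede_cat u v x y :
  supersede x y -> supersede (u ++ x ++ v) (u ++ y ++ v).
Proof. by case=> p s a b le_ab; rewrite -!catA !cat_cons !(catA u p); constructor. Qed.

Lemma word_le_cat x y x' y' :
  word_le x y -> word_le x' y' -> word_le (x ++ x') (y ++ y').
Proof.
move=> xy x'y'; apply: (@rt_trans _ _ _ (x ++ y')).
  elim: xy => [p q pq|p|p q r _ pq _ qr]; last exact: rt_trans pq qr.
  - by apply: rt_step; exact: (supersede_cat [::] y' pq).
  - exact: rt_refl.
elim: x'y' => [p q pq|p|p q r _ pq _ qr]; last exact: rt_trans pq qr.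
- by apply: rt_step; have := supersede_cat x [::] pq; rewrite !cats0.
- exact: rt_refl.
Qed.

(** The letters of [u] vanish from right to left, each one standing just before [k] when it is
    erased. *)
Lemma word_le_suffix u v k :
  all (fun a => a <= k) u -> word_le (k :: v) (u ++ k :: v).
Proof.
elim: u => [|a u IHu] /=; first by move=> _; exact: rt_refl.
case/andP=> le_ak /IHu le_u; apply: (@word_le_trans _ (a :: k :: v)).
  by apply: rt_step; exact: (Supersede [::] v le_ak).
exact: (@word_le_cat [:: a] [:: a] _ _ (rt_refl _ _ _) le_u).
Qed.

(** The bound is a number, not a letter, so that [d.+1] captures all words. *)
Definition letters_below n x := all (fun a => a < n) x.

Lemma letters_below_split k x : letters_below k.+1 x -> ~~ letters_below k x ->
  exists u v, [/\ x = u ++ k :: v, letters_below k u & letters_below k.+1 v].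
Proof.
elim: x => //= a x IHx /andP[]; rewrite ltnS leq_eqVlt => /predU1P[/val_inj-> xk|].
  by rewrite ltnn => _; exists [::], x.
move=> lt_ak xk; rewrite lt_ak /= => /(IHx xk)[u [v [-> uk vk]]].
by exists (a :: u), v; split; rewrite //= lt_ak.
Qed.

Definition leading k x := exists2 v, x = k :: v & letters_below k.+1 v.

(** The reduction to words starting with [k], used both for arbitrary words and for the tails of a
    minimal bad sequence. The prefixes before the first [k] are thinned to a chain first, so that
    any good pair of suffixes also has comparable prefixes. *)
Lemma good_of_leading_suffixes k (x : nat -> word d) :
  wqo_on (letters_below k) word_le -> (forall n, letters_below k.+1 (x n)) ->
  (forall f t, increasing f -> (forall n, leading k (t n)) ->
     (forall n, exists u, x (f n) = u ++ t n) -> good word_le t) ->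
  good word_le x.
Proof.
move=> wqo_k xk1 good_suffix.
have [f [f_inc [b fb]]] := finite_constant_subsequence (fun n => letters_below k (x n)).
case: b fb => fb.
  have [i [j [lt_ij le_ij]]] := wqo_k (x \o f) fb.
  by exists (f i), (f j); split; first exact: f_inc.
have [n|uv uvP] := @choice_fun nat (word d * word d) (fun n uv =>
    [/\ x (f n) = uv.1 ++ uv.2, letters_below k uv.1 & leading k uv.2]).
  have nbelow : ~~ letters_below k (x (f n)) by rewrite fb.
  have [u [v [-> uk vk]]] := letters_below_split (xk1 (f n)) nbelow.
  by exists (u, k :: v); split=> //; exists v.
have u_below n : letters_below k (uv n).1 by case: (uvP n).
have [g [g_inc gP]] := wqo_on_chain word_le_trans wqo_k u_below.
have [||n|i [j [lt_ij le_ij]]] := good_suffix (f \o g) (fun n => (uv (g n)).2).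
- exact: increasing_comp.
- by move=> n; case: (uvP (g n)).
- by exists (uv (g n)).1; case: (uvP (g n)).
exists (f (g i)), (f (g j)); split; first exact/f_inc/g_inc.
have [-> _ _] := uvP (g i); have [-> _ _] := uvP (g j).
by apply: word_le_cat => //; exact: gP.
Qed.

Lemma wqo_leading k : wqo_on (letters_below k) word_le -> wqo_on (leading k) word_le.
Proof.
move=> wqo_k; apply: NNPP.
move=> /(minimal_bad_sequence word_le_trans size)[w [w_lead [w_bad w_min]]].
apply: w_bad.
have [n|x xP] := @choice_fun nat (word d) (fun n x =>
    w n = k :: x /\ letters_below k.+1 x).
  by have [x] := w_lead n; exists x.
have [n|f t f_inc t_lead t_suffix|i [j [lt_ij le_ij]]] :=
    @good_of_leading_suffixes k x wqo_k.
- by case: (xP n).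
(* A suffix [t n] of [x (f n)] arises from [w (f n)] by erasing [k :: u], hence is below it and
   strictly shorter. *)
- apply: (w_min f) => // n; have [-> ] := xP (f n).
  have [u ->] := t_suffix n; have [v -> _] := t_lead n.
  rewrite /letters_below all_cat => /andP[uk _]; split.
    by apply: (@word_le_suffix (k :: u)); rewrite /= leqnn.
  by rewrite /= size_cat ltnS leq_addl.
exists i, j; split=> //; rewrite (xP i).1 (xP j).1.
exact: (@word_le_cat [:: k] [:: k] _ _ (rt_refl _ _ _) le_ij).
Qed.

Lemma wqo_letters_below n : n <= d.+1 -> wqo_on (letters_below n) word_le.
Proof.
elim: n => [_|n IHn lt_nd] x xn.
  have x_nil i : x i = [::] by case: (x i) (xn i).
  by exists 0, 1; rewrite !x_nil; split=> //; exact: rt_refl.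
have wqo_n := IHn (ltnW lt_nd); pose k : letter d := Ordinal lt_nd.
apply: (@good_of_leading_suffixes k) => // f t _ t_lead _.
exact: (@wqo_leading k).
Qed.

Lemma wqo_word : wqo_on (fun=> True) word_le.
Proof.
move=> x _; apply: (wqo_letters_below (leqnn d.+1)) => n.
by apply/allP => a _; exact: ltn_ord.
Qed.

(* Dickson's lemma *)
Lemma channelwise_chain (C : finType) (x : nat -> {ffun C -> word d}) :
  exists f, increasing f /\
    forall c i j, i < j -> word_le (x (f i) c) (x (f j) c).
Proof.
suff [f [f_inc fP]] : exists f, increasing f /\
    forall c, c \in enum C -> forall i j, i < j -> word_le (x (f i) c) (x (f j) c).
  by exists f; split=> // c; apply: fP; rewrite mem_enum.
(* The subsequence is refined once per channel; chains found earlier survive. *)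
elim: (enum C) => [|c s [f [f_inc fP]]]; first by exists id; split.
have [//|g [g_inc gP]] :=
  wqo_on_chain word_le_trans wqo_word (x := fun n => x (f n) c).
exists (f \o g); split; first exact: increasing_comp.
move=> c'; rewrite inE => /predU1P[-> //|c's] i j /g_inc; exact: fP.
Qed.

(** * Configurations of a priority channel system *)

Section Configurations.
Context (S : pcs d).
Implicit Types (q : state S).

Lemma pcs_le_update q (x y : {ffun chan S -> word d}) c :
  clos_refl_trans _ supersede (x c) (y c) -> (forall c', c' != c -> x c' = y c') ->
  pcs_le (q, y) (q, x).
Proof.
pose upd (z : word d) : {ffun chan S -> word d} :=
  [ffun c' => if c' == c then z else y c'].
(* With both contents written as [upd] of one word, induction on the superseding sequence
   applies. *)
move=> xy eq_xy; have -> : x = upd (x c).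
  by apply/ffunP => c'; rewrite ffunE; case: eqVneq => [->|/eq_xy].
have -> : y = upd (y c).
  by apply/ffunP => c'; rewrite ffunE; case: eqVneq => [->|].
elim: xy => [u v uv|u|u v z _ uv _ vz]; last exact: rt_trans uv vz.
- apply: rt_step; apply: (@InternalStep _ _ q c); first by rewrite !ffunE eqxx.
  by move=> c' /negPf ne; rewrite !ffunE ne.
- exact: rt_refl.
Qed.

Lemma pcs_le_channelwise q (x y : {ffun chan S -> word d}) :
  (forall c, word_le (x c) (y c)) -> pcs_le (q, x) (q, y).
Proof.
move=> le_xy.
(* [mix s] already holds [x] on the channels in [s], so [y] is turned into [x] one channel at a
   time. *)
pose mix (s : seq (chan S)) : {ffun chan S -> word d} :=
  [ffun c => if c \in s then x c else y c].
have -> : x = mix (enum (chan S)).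
  by apply/ffunP => c; rewrite ffunE mem_enum.
elim: (enum _) => [|c s IHs].
  have -> : mix [::] = y by apply/ffunP => c; rewrite ffunE.
  exact: rt_refl.
apply: rt_trans IHs _; apply: (@pcs_le_update _ _ _ c); rewrite ?ffunE.
  by rewrite inE eqxx /=; case: ifP => _; [exact: rt_refl | exact: le_xy].
by move=> c' /negPf ne; rewrite !ffunE inE ne.
Qed.

Lemma wqo_pcs_le : well_quasi_order (@pcs_le d S).
Proof.
split; first by split=> [C|C D E CD DE]; [exact: rt_refl | exact: rt_trans DE CD].
move=> C; have [f [f_inc [q fq]]] := finite_constant_subsequence (fun n => (C n).1).
have [g [g_inc gP]] := channelwise_chain (fun n => (C (f n)).2).
exists (f (g 0)), (f (g 1)); split; first exact/f_inc/g_inc.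
have := fq (g 0); have := fq (g 1); have := fun c => gP c 0 1 (ltn0Sn 0).
case: (C _) (C _) => [q0 x] [q1 y] /= le_xy -> ->; exact: pcs_le_channelwise.
Qed.

Lemma pcs_stuttering_compatible : stuttering_compatible (@pcs_step d S) (@pcs_le d S).
Proof.
move=> C D C' CD C'C; exists D; split; last exact: rt_refl.
(* The step out of [C] comes last, so the run from [C'] is nonempty even when [C'] is [C]. *)
elim/clos_refl_trans_ind_right: C'C => [|E F EF FD _]; first exact: t_step.
by apply: t_trans FD; apply: t_step; right.
Qed.

End Configurations.
End Words.

Theorem theorem2p12 (d : nat) (S : pcs d) :
  stuttering_wsts (@pcs_step d S) (@pcs_le d S).
Proof. by split; [exact: wqo_pcs_le | exact: pcs_stuttering_compatible]. Qed.
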